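(* For every positive integer $n$, $$r(3;n) \;\leq\; R(P_{n+2},\mathcal{J}_n) \;\leq\; 4^n \cdot r(3;n).$$
   Context: For positive integers $m,n$, the multicolor Ramsey number $r(m;n)$ is the smallest $N$ such that every coloring of the edges of the complete graph $K_N$ with $n$ colors contains a monochromatic complete subgraph on $m$ vertices. An ordered 3-uniform hypergraph is a 3-uniform hypergraph whose vertex set is totally ordered. For a vertex $v$ of such a hypergraph, $v+1$ denotes the vertex immediately succeeding $v$ in the order, $v-1$ the vertex immediately preceding it, and similarly $v+2$, $v-2$, etc. $K^{(3)}_N$ denotes the complete ordered 3-uniform hypergraph on vertex set $[N]=\{1,\dots,N\}$ with its natural order (all triples are edges). An ordered hypergraph $H$ is contained in a red-blue coloring of the triples of $[N]$ as a red (resp. blue) copy if there is an order-preserving injection $V(H)\to[N]$ mapping every edge of $H$ to a red (resp. blue) triple. The monotone path $P_k$ is the ordered 3-uniform hypergraph with vertex set $\{1,\dots,k\}$ and edge set consisting of all consecutive triples $(i,i+1,i+2)$. $\mathcal{J}_n$ (''monotone paths with $n$ jumps'') is the collection of ordered 3-uniform hypergraphs $H$ such that $H$ contains all consecutive triples $(v,v+1,v+2)$ as edges (and possibly other edges), and there exists a vertex subset $J\subset V(H)$ with $|J|=n$ satisfying: (0) $J$ contains no two consecutive vertices, and does not contain the first or the last vertex of $H$; (1) for each $v\in J$, the triples $(v-2,v-1,v+1)$ and $(v-1,v+1,v+2)$ are edges of $H$; (2) if $v-1\in J$ and $v+1\in J$, then $(v-2,v,v+2)$ is an edge of $H$. $R(P_{n+2},\mathcal{J}_n)$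 is the smallest $N$ such that every red-blue coloring of the triples of $K^{(3)}_N$ contains a red copy of $P_{n+2}$ or a blue copy of some member of $\mathcal{J}_n$. *)

(* Defs.v *)
From mathcomp Require Import all_boot.

Set Implicit Arguments.
Unset Strict Implicit.
Unset Printing Implicit Defensive.

Definition is_least (P : nat -> Prop) (N : nat) : Prop :=
  P N /\ forall M, P M -> N <= M.

(* Edges of K_N are the 2-subsets of 'I_N; a colouring is given as a total
   function on sets, of which only the values on 2-subsets are ever used. *)
Definition multicolor_arrows (m n N : nat) : Prop :=
  forall c : {set 'I_N} -> 'I_n,
  exists (i : 'I_n) (S : {set 'I_N}),
    #|S| = m /\ forall e : {set 'I_N}, e \subset S -> #|e| = 2 -> c e = i.

(* r(m; n) = N *)
Definition is_multicolor_ramsey (m n N : nat) : Prop :=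
  is_least (multicolor_arrows m n) N.

(* A finite totally ordered vertex set with k elements is identified with
   'I_k = {0, ..., k-1} in its natural order. *)
Record ordered_3graph : Type := Ordered3Graph {
  nvert : nat;
  edges : {set {set 'I_nvert}};
  edges_uniform : [forall e in edges, #|e| == 3]
}.

(* The vertices are given by their values in nat; a value >= k contributes no
   element, so that an edge of a 3-graph of this form always consists of
   three genuine, distinct vertices. *)
Definition triple (k a b c : nat) : {set 'I_k} :=
  [set x : 'I_k | (x : nat) \in [:: a; b; c]].

Definition has_edge (H : ordered_3graph) (a b c : nat) : Prop :=
  triple (nvert H) a b c \in edges H.

Definition path_edges (k : nat) : {set {set 'I_k}} :=
  [set e | [exists v : 'I_k, (v.+2 < k) && (e == triple k v v.+1 v.+2)]].

Lemma card_triple (k a b c : nat) : a < b -> b < c -> c < k ->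
  #|triple k a b c| = 3.
Proof.
move=> ab bc ck; have bk := ltn_trans bc ck; have ak := ltn_trans ab bk.
have -> : triple k a b c
    = [set Ordinal ak; Ordinal bk; Ordinal ck].
  by apply/setP=> x; rewrite !inE -!val_eqE /= orbA.
rewrite setUC cardsU1 cards2 !inE -!val_eqE /=.
by rewrite (gtn_eqF bc) (gtn_eqF (ltn_trans ab bc)) (ltn_eqF ab).
Qed.

Lemma path_edges_uniform (k : nat) : [forall e in path_edges k, #|e| == 3].
Proof.
apply/forall_inP=> e; rewrite inE => /existsP[v /andP[vk /eqP->]].
by rewrite card_triple.
Qed.

Definition monotone_path (k : nat) : ordered_3graph :=
  Ordered3Graph (path_edges_uniform k).

(* The predecessors below are truncated, but only meet the range where they
   are genuine: vertices of J are positive by the second clause, and so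
   1 < v in the last one.  A jump may sit on the second (or on the last but
   one) vertex; the triple using the nonexistent vertex v - 2 (or v + 2) is
   then not required. *)
Definition is_jump_set (H : ordered_3graph) (J : {set 'I_(nvert H)}) : Prop :=
  [/\ forall v w : 'I_(nvert H), v \in J -> w \in J -> (w : nat) <> v.+1,
      forall v : 'I_(nvert H), v \in J -> 0 < v /\ v.+1 < nvert H,
      forall v : 'I_(nvert H), v \in J ->
        (1 < v -> has_edge H (v - 2) (v - 1) (v + 1)) /\
        (v + 2 < nvert H -> has_edge H (v - 1) (v + 1) (v + 2))
    & forall u v w : 'I_(nvert H),
        (v : nat) = u.+1 -> (w : nat) = v.+1 -> u \in J -> w \in J ->
        has_edge H (v - 2) v (v + 2)].

Definition monotone_path_with_jumps (n : nat) (H : ordered_3graph) : Prop :=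
  (forall v : nat, v + 2 < nvert H -> has_edge H v (v + 1) (v + 2)) /\
  exists J : {set 'I_(nvert H)}, #|J| = n /\ is_jump_set J.

Inductive color : Set := Red | Blue.

(* As above, only the values of c on 3-subsets matter. *)
Definition contains_copy (N : nat) (c : {set 'I_N} -> color) (a : color)
    (H : ordered_3graph) : Prop :=
  exists f : 'I_(nvert H) -> 'I_N,
    (forall i j : 'I_(nvert H), i < j -> f i < f j) /\
    forall e : {set 'I_(nvert H)}, e \in edges H -> c (f @: e) = a.

Definition ordered_arrows (G : ordered_3graph) (F : ordered_3graph -> Prop)
    (N : nat) : Prop :=
  forall c : {set 'I_N} -> color,
    contains_copy c Red G \/ exists2 H, F H & contains_copy c Blue H.

(* R(G, F) = N *)
Definition is_ordered_ramsey (G : ordered_3graph) (F : ordered_3graph -> Prop)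
    (N : nat) : Prop :=
  is_least (ordered_arrows G F) N.

(* Main.v *)
(* Lower bound.  Given an edge colouring chi, colour a triple a < b < d red
   when chi ab < chi bd: n+1 consecutive edges of a red path would carry n+1
   increasing colours.  At a jump v of a blue path with jumps, put
   hi v = max (chi (v-1, v), chi (v-1, v+1)) and
   lo v = min (chi (v, v+1), chi (v-1, v+1)).  Then lo v >= hi w for jumps
   v < w, and hi v > lo v unless v-1, v, v+1 is monochromatic, so n jumps
   without a monochromatic triangle need n+1 colours.

   Upper bound.  Without a red path on n+2 vertices, the length of the longest
   red path ending in ab colours the edges with n colours, and a < b < d is
   blue as soon as chi bd <= chi ab.  Hence n monochromatic triangles, each
   starting where the previous one ends and with nonincreasing colours, form
   a blue path with n jumps.  Label v by the function mapping a colour i to the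
   length of the longest such chain ending in v with last colour at least i.
   If all lengths are < n, the labels are nonincreasing functions, at most 4^n
   in number, so r(3; n) vertices share a label; a triangle of colour i among
   them extends a longest chain at its first vertex to a longer one at its
   last vertex, a contradiction. *)
Require Import Defs.
From mathcomp Require Import all_boot zify.
From Stdlib Require Import Classical.

Set Implicit Arguments.
Unset Strict Implicit.
Unset Printing Implicit Defensive.

(** * Minima, counting and sorted enumerations *)

Lemma ex_is_least (P : nat -> Prop) N : P N -> exists2 M, M <= N & is_least P M.
Proof.
elim/ltn_ind: N => N IH PN.
have [[M [MN PM]]|noM] := classic (exists M, M < N /\ P M).
  by have [K KM leastK] := IH M MN PM; exists K => //; lia.
exists N => //; split=> // M PM; rewrite leqNgt; apply/negP => MN.
by apply: noM; exists M.
Qed.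

Lemma pigeonhole (T U : finType) (f : T -> U) (A : {set T}) (B : {set U}) r :
    {in A, forall x, f x \in B} -> #|B| * r < #|A| ->
  exists2 u, u \in B & r < #|[set x in A | f x == u]|.
Proof.
move=> fB ltA; apply/exists_inP; apply: contraLR ltA.
rewrite negb_exists_in -leqNgt => /forall_inP small.
rewrite -sum1_card (partition_big f (mem B)) //= -sum_nat_const.
apply: leq_sum => u uB; rewrite leqNgt.
by move: (small u uB); rewrite -sum1dep_card.
Qed.

Lemma ltn_steps (g : nat -> nat) m :
  (forall i, i < m -> g i < g i.+1) -> forall i j, i < j <= m -> g i < g j.
Proof.
move=> step i; elim=> [|j IH]; first lia.
case/andP; rewrite ltnS leq_eqVlt => /predU1P[-> | ij] jm; first exact: step.
by apply: ltn_trans (step j jm); apply: IH; lia.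
Qed.

Lemma bin_le_exp2 n k : 'C(n, k) <= 2 ^ n.
Proof.
have [kn|] := leqP k n; last by move=> nk; rewrite bin_small.
rewrite -(addn1 1) expnDn (bigD1 (inord k : 'I_n.+1)) //= inordK //.
by rewrite !exp1n !muln1 leq_addr.
Qed.

Lemma sorted_enum_ord N (A : {set 'I_N}) : sorted ltn (map val (enum A)).
Proof.
apply: (subseq_sorted ltn_trans) (map_subseq val (filter_subseq _ _)) _.
by rewrite -enumT val_enum_ord iota_ltn_sorted.
Qed.

Lemma enum_sorted N (s : seq 'I_N) :
  sorted ltn (map val s) -> enum [set x in s] = s.
Proof.
move=> ss; apply: (inj_map val_inj).
apply: (irr_sorted_eq ltn_trans ltnn) (sorted_enum_ord _) ss _.
by apply: eq_mem_map => x; rewrite mem_enum inE.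
Qed.

Lemma enum_pair N (a b : 'I_N) : a < b -> enum [set a; b] = [:: a; b].
Proof.
move=> ab; suff -> : [set a; b] = [set x in [:: a; b]] by rewrite enum_sorted //= ab.
by apply/setP=> x; rewrite !inE.
Qed.

Lemma enum_three N (a b d : 'I_N) :
  a < b -> b < d -> enum [set a; b; d] = [:: a; b; d].
Proof.
move=> ab bd; suff -> : [set a; b; d] = [set x in [:: a; b; d]].
  by rewrite enum_sorted //= ab bd.
by apply/setP=> x; rewrite !inE orbA.
Qed.

Lemma card3_sorted N (S : {set 'I_N}) : #|S| = 3 ->
  exists a b d : 'I_N, [/\ a < b, b < d & S = [set a; b; d]].
Proof.
move=> S3; have := sorted_enum_ord S; have := mem_enum S; move: S3.
rewrite cardE; case: (enum S) => [|a [|b [|d [|? ?]]]] //= _ eS /and3P[ab bd _].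
by exists a, b, d; split=> //; apply/setP=> x; rewrite -eS !inE orbA.
Qed.

Lemma triple_ord k (a b d : 'I_k) : triple k a b d = [set a; b; d].
Proof. by apply/setP=> x; rewrite !inE -!val_eqE orbA. Qed.

Lemma imset_three (T U : finType) (f : T -> U) a b d :
  f @: [set a; b; d] = [set f a; f b; f d].
Proof. by rewrite !imsetU !imset_set1. Qed.

(** * Monochromatic triangles *)

Definition mono_triangle N n (chi : 'I_N -> 'I_N -> 'I_n) i
    (a b d : 'I_N) : bool :=
  [&& a < b, b < d, chi a b == i, chi b d == i & chi a d == i].

(** Pull [chi] back along an injection of ['I_r] into [A]. As [chi] need not be symmetric, the
    increasing enumeration of a pair fixes the order of its arguments. *)
Lemma arrows_mono_triangle m r N (A : {set 'I_N})
    (chi : 'I_N -> 'I_N -> 'I_m.+1) :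
    multicolor_arrows 3 m.+1 r -> r <= #|A| ->
  exists i a b d, [/\ a \in A, d \in A & mono_triangle chi i a b d].
Proof.
move=> arr rA; pose h (x : 'I_r) : 'I_N := enum_val (widen_ord rA x).
have h_inj : injective h by move=> x y /enum_val_inj/(congr1 val)/= /val_inj.
pose col (e : {set 'I_r}) : 'I_m.+1 :=
  if enum (h @: e) is [:: a; b] then chi a b else ord0.
have [i [S [S3 monoS]]] := arr col.
have [|a [b [d [ab bd hS]]]] := @card3_sorted N (h @: S).
  by rewrite card_imset.
have in_hS x : x \in [set a; b; d] -> exists2 y, y \in S & x = h y.
  by rewrite -hS => /imsetP.
have chiE x y : x \in [set a; b; d] -> y \in [set a; b; d] -> x < y ->
  chi x y == i.
  move=> /in_hS[x' x'S ->] /in_hS[y' y'S ->] xy; apply/eqP.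
  rewrite -(monoS [set x'; y']).
  - by rewrite /col imsetU !imset_set1 enum_pair.
  - by rewrite subUset !sub1set x'S.
  - by rewrite cards2; case: eqP xy => // ->; rewrite ltnn.
exists i, a, b, d; split.
- by have [|y _ ->] := in_hS a; rewrite ?inE ?eqxx //; apply: enum_valP.
- by have [|y _ ->] := in_hS d; rewrite ?inE ?eqxx ?orbT //; apply: enum_valP.
- by rewrite /mono_triangle ab bd !chiE ?inE ?eqxx ?orbT // (ltn_trans ab).
Qed.

(** * Red paths and the edge colouring by their length *)

Definition is_red x := if x is Red then true else false.

(* A red path on k.+2 vertices whose last two vertices are a < b. *)
Fixpoint red_path N (c : {set 'I_N} -> color) k (a b : 'I_N) : bool :=
  (a < b) && if k is k'.+1 then
    [exists z, red_path c k' z a && is_red (c [set z; a; b])] else true.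

Lemma red_pathP N (c : {set 'I_N} -> color) k a b : red_path c k a b ->
  exists f : nat -> 'I_N, [/\ f k = a, f k.+1 = b,
    forall i, i < k.+1 -> f i < f i.+1 &
    forall i, i < k -> c [set f i; f i.+1; f i.+2] = Red].
Proof.
elim: k a b => [|k IH] a b /=.
  rewrite andbT => ab; exists (fun i => if i == 0 then a else b).
  by split=> // -[].
case/andP=> ab /existsP[z /andP[/IH[f [fz fa f_lt f_red]]]].
case zab: (c _) => //= _; exists (fun i => if i == k.+2 then b else f i).
split; rewrite ?eqxx ?ltn_eqF //.
- move=> i; rewrite ltnS leq_eqVlt => /predU1P[-> | ik].
    by rewrite eqxx ltn_eqF // fa.
  by rewrite !ltn_eqF ?f_lt //; lia.
- move=> i; rewrite ltnS leq_eqVlt => /predU1P[-> | ik].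
    by rewrite eqxx !ltn_eqF ?fz ?fa //; lia.
  by rewrite !ltn_eqF ?f_red //; lia.
Qed.

Lemma red_path_copy N (c : {set 'I_N} -> color) k a b :
  red_path c k a b -> contains_copy c Red (monotone_path k.+2).
Proof.
case/red_pathP=> f [_ _ f_lt f_red]; exists (fun i => f i); split.
  by move=> i j ij; apply: (ltn_steps f_lt); rewrite ij -ltnS ltn_ord.
move=> e; rewrite inE => /existsP[v /andP[vk /eqP->]].
have v1k : v.+1 < k.+2 := ltnW vk.
by rewrite (triple_ord v (Ordinal v1k) (Ordinal vk)) imset_three /= f_red.
Qed.

(** Level k stands for k + 2 vertices, so the cap at [m] loses nothing when no red path has m + 3
    vertices. Pairs that are not increasing get the default 0. *)
Definition red_level m N (c : {set 'I_N} -> color) (a b : 'I_N) : 'I_m.+1 :=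
  [arg max_(k > ord0 | red_path c k a b) (k : nat)].

(** Were the triple red, appending [d] to a longest red path ending in [a], [b] would give the pair
    [b], [d] a higher level. *)
Lemma blue_of_red_level m N (c : {set 'I_N} -> color) (a b d : 'I_N) :
    ~ contains_copy c Red (monotone_path m.+3) -> a < b -> b < d ->
  red_level m c b d <= red_level m c a b -> c [set a; b; d] = Blue.
Proof.
move=> noRed ab bd; case abd: (c _) => //; rewrite leqNgt => /negP[].
rewrite {1}/red_level; case: arg_maxnP => /= [|k kP _]; first by rewrite ab.
have kbd : red_path c k.+1 b d.
  by rewrite /= bd; apply/existsP; exists a; rewrite kP abd.
have km : k.+1 < m.+1.
  rewrite ltn_neqAle ltn_ord andbT; apply/eqP=> km; apply: noRed.
  by rewrite -km; apply: red_path_copy kbd.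
rewrite /red_level; case: arg_maxnP => /= [|l lP max_l]; first by rewrite bd.
exact: (max_l (Ordinal km)).
Qed.

(** * Chains of triangles as blue paths with jumps *)

(* A chain of j triangles ending in v, the last one of colour at least i. *)
Fixpoint mono_chain N n (chi : 'I_N -> 'I_N -> 'I_n) j
    (v : 'I_N) (i : 'I_n) : bool :=
  if j is j'.+1 then
    [exists a, exists b, exists i' : 'I_n,
      [&& i <= i', mono_triangle chi i' a b v & mono_chain chi j' a i']]
  else true.

Lemma mono_chain_le N n (chi : 'I_N -> 'I_N -> 'I_n) j v (i i' : 'I_n) :
  i <= i' -> mono_chain chi j v i' -> mono_chain chi j v i.
Proof.
case: j => //= j ii' /existsP[a /existsP[b /existsP[l /and3P[il tri ch]]]].
apply/existsP; exists a; apply/existsP; exists b; apply/existsP; exists l.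
by rewrite (leq_trans ii' il) tri.
Qed.

(** Triangle [s] occupies positions 2s, 2s + 1, 2s + 2 of [f]: odd positions are the middle
    vertices, which later serve as the jumps. *)
Lemma mono_chainP N n (chi : 'I_N -> 'I_N -> 'I_n) j v i :
  mono_chain chi j v i -> exists (f : nat -> 'I_N) (g : nat -> 'I_n),
  [/\ f j.*2 = v,
      forall s, s < j ->
        mono_triangle chi (g s) (f s.*2) (f s.*2.+1) (f s.+1.*2),
      forall s, s < j -> i <= g s &
      forall s t, s <= t -> t < j -> g t <= g s].
Proof.
elim: j v i => [|j IH] v i /=; first by exists (fun=> v), (fun=> i).
case/existsP=> a /existsP[b /existsP[l /and3P[il tri]]].
case/IH=> f [g [fa ftri gl g_mono]].
exists (fun t => if t <= j.*2 then f t else if t == j.*2.+1 then b else v).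
exists (fun s => if s < j then g s else l); split.
- by rewrite leqNgt doubleS ltnS leqnSn /= eqn_leq ltnn.
- move=> s; rewrite ltnS leq_eqVlt => /predU1P[-> | sj].
    by rewrite leqnn !ltnn doubleS eqxx fa leqNgt ltnS leqnSn eqn_leq ltnn.
  by rewrite sj !ifT ?ftri //; lia.
- move=> s _; case: ifP => // sj; exact: leq_trans il (gl s sj).
- move=> s t st tj; case: (ltnP t j) => jt; first by rewrite ifT ?g_mono //; lia.
  by case: ifP => // /gl.
Qed.

Lemma mono_chain_jumps N n (c : {set 'I_N} -> color)
    (chi : 'I_N -> 'I_N -> 'I_n) v i :
    (forall a b d : 'I_N, a < b -> b < d -> chi b d <= chi a b ->
      c [set a; b; d] = Blue) ->
    mono_chain chi n v i ->
  exists2 H, monotone_path_with_jumps n H & contains_copy c Blue H.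
Proof.
move=> blue /mono_chainP[f [g [_ tri _ g_mono]]]; pose k := n.*2.+1.
have f_lt : forall s t, s < t <= n.*2 -> f s < f t.
  apply: ltn_steps => s sn; have := odd_double_half s.
  have: s./2 < n by lia.
  move/tri => /and5P[ab bd _ _ _]; case: (odd s) => /= <-.
    by rewrite add1n -doubleS.
  by rewrite add0n.
pose F (t : 'I_k) := f t.
(* With every blue triple as an edge, the copy is blue by construction, and only the presence of the
   required edges remains to be shown. *)
pose E := [set e : {set 'I_k} | (#|e| == 3) && ~~ is_red (c (F @: e))].
have E3 : [forall e in E, #|e| == 3].
  by apply/forall_inP=> e; rewrite inE => /andP[].
pose H := Ordered3Graph E3.
(* The sides of the triangles: consecutive positions, or the long side over an odd position. A side
   starting at [a] has colour [g a./2], so two successive sides have nonincreasing colours and span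
   a blue triple. *)
pose step a b := (b == a.+1) || (~~ odd a && (b == a.+2)).
have chi_step a b (la : a < k) (lb : b < k) : step a b -> chi (f a) (f b) = g a./2.
  rewrite /step; have aE := odd_double_half a.
  case/orP=> [/eqP bE | /andP[ea /eqP bE]].
    have /tri/and5P[_ _ /eqP c1 /eqP c2 _] : a./2 < n by lia.
    by case: (odd a) aE => /= aE; [rewrite -c2 | rewrite -c1];
      congr (chi (f _) (f _)); lia.
  have /tri/and5P[_ _ _ _ /eqP c3] : a./2 < n by lia.
  rewrite -c3; congr (chi (f _) (f _)); lia.
have edge a b d : step a b -> step b d -> d < k -> has_edge H a b d.
  move=> sab sbd dk.
  have ab : a < b by move: sab; rewrite /step; lia.
  have bd : b < d by move: sbd; rewrite /step; lia.
  have bk := ltn_trans bd dk; have ak := ltn_trans ab bk.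
  rewrite /has_edge /= inE card_triple //=.
  rewrite (triple_ord (Ordinal ak) (Ordinal bk) (Ordinal dk)) imset_three /F /=.
  rewrite blue ?f_lt //; try by rewrite ?ab ?bd /=; lia.
  by rewrite !chi_step // g_mono //; move: sab sbd; rewrite /step; lia.
exists H; last first.
  exists F; split=> [s t st | e]; first by apply: f_lt; rewrite st -ltnS ltn_ord.
  by rewrite inE => /andP[_]; case: (c _).
split=> [t /= tk|]; first by apply: edge; rewrite // /step; lia.
have jk (s : 'I_n) : s.*2.+1 < k by have := ltn_ord s; rewrite /k; lia.
exists [set Ordinal (jk s) | s : 'I_n]; split.
  rewrite card_imset ?card_ord // => s t /(congr1 val)/= st.
  by apply: val_inj; move: st => /=; lia.
have kE : nvert H = k by [].
have inJ (w : 'I_(nvert H)) : w \in [set Ordinal (jk s) | s : 'I_n] ->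
    odd w /\ w.+1 < k.
  by case/imsetP=> s _ -> /=; have := ltn_ord s; rewrite /k; lia.
split=> [t w /inJ[] ? _ /inJ[] ? _ | t /inJ[] ? ? | t /inJ[] ot lt
        | t w y wE yE /inJ[] ot lt /inJ[] oy ly].
- lia.
- by split; lia.
- by split=> ?; apply: edge; rewrite /step; lia.
- by apply: edge; rewrite /step; lia.
Qed.

(** * The upper bound *)

Lemma ordered_arrows_upper m r : multicolor_arrows 3 m.+1 r ->
  ordered_arrows (monotone_path m.+3) (monotone_path_with_jumps m.+1)
    (4 ^ m.+1 * r).
Proof.
set N := 4 ^ m.+1 * r => arr c.
have [|noRed] := classic (contains_copy c Red (monotone_path m.+3)).
  by left.
right; pose chi : 'I_N -> 'I_N -> 'I_m.+1 := red_level m c.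
have blue (a b d : 'I_N) : a < b -> b < d -> chi b d <= chi a b ->
  c [set a; b; d] = Blue by move=> *; apply: (@blue_of_red_level m).
have [/existsP[v]|noChain] := boolP [exists v, mono_chain chi m.+1 v ord0].
  exact: mono_chain_jumps.
(* The cap at [m] is harmless: a chain of length m + 1 for any colour is also one for [ord0], which
   [noChain] excludes. *)
pose height v i : 'I_m.+1 :=
  [arg max_(j > ord0 | mono_chain chi j v i) (j : nat)].
have heightP v i : mono_chain chi (height v i) v i.
  by rewrite /height; case: arg_maxnP.
have height_max v i j : mono_chain chi j v i -> j < m.+1 -> j <= height v i.
  move=> jP jm; rewrite /height; case: arg_maxnP => // l _ max_l.
  exact: (max_l (Ordinal jm)).
pose label v := [tuple rev_ord (height v i) | i < m.+1].
(* Reversing the heights turns a nonincreasing label into a sorted tuple. *)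
pose B := [set t : m.+1.-tuple 'I_m.+1 | sorted leq [seq \val i | i <- t]].
have B4 : #|B| <= 4 ^ m.+1.
  (* The count is the binomial coefficient of 2m + 1 over m + 1, at most 2 ^ (2m + 1). *)
  rewrite card_sorted_tuples; apply: leq_trans (bin_le_exp2 _ _) _.
  by rewrite -[4]/(2 ^ 2) -expnM leq_exp2l //; lia.
have label_sorted v : label v \in B.
  rewrite inE /= -map_comp.
  have := sub_sorted ltnW (sorted_enum_ord [set: 'I_m.+1]).
  have -> : enum [set: 'I_m.+1] = enum 'I_m.+1.
    by apply: eq_enum => x; rewrite !inE.
  rewrite !sorted_map; apply: sub_sorted => i i' /= ii'.
  by have := height_max v i _ (mono_chain_le ii' (heightP v i')) (ltn_ord _); lia.
have r0 : 0 < r.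
  rewrite lt0n; apply/eqP=> r0; subst r.
  have [_ [S [S3 _]]] := arr (fun=> ord0).
  by have := max_card S; rewrite S3 card_ord.
(* A class with more than r - 1 vertices has at least r, since r is positive. *)
have [|t _ ltA] :=
    @pigeonhole _ _ label [set: 'I_N] B r.-1 (fun v _ => label_sorted v).
  rewrite cardsT card_ord; apply: leq_ltn_trans (leq_mul B4 (leqnn _)) _.
  by rewrite ltn_pmul2l ?expn_gt0 //; lia.
rewrite prednK // in ltA.
have [i [a [b [d [aA dA tri]]]]] := arrows_mono_triangle chi arr ltA.
have eq_height : height d i = height a i.
  move: aA dA; rewrite !inE => /eqP <- /eqP/(congr1 (fun t => tnth t i)).
  by rewrite !tnth_mktuple => /rev_ord_inj.
have chain_d : mono_chain chi (height a i).+1 d i.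
  apply/existsP; exists a; apply/existsP; exists b; apply/existsP; exists i.
  by apply/and3P; split=> //; apply: heightP.
(* The extended chain either beats the maximal height or has length m + 1, against [noChain]. *)
have [lt_m|ge_m] := ltnP (height a i).+1 m.+1.
  by have := height_max _ _ _ chain_d lt_m; rewrite eq_height ltnn.
case/negP: noChain; apply/existsP; exists d.
have eq_m : (height a i).+1 = m.+1 by have := ltn_ord (height a i); lia.
by rewrite eq_m in chain_d; apply: mono_chain_le chain_d.
Qed.

(** * Existence of r(3; n) *)

Lemma multicolor_arrows_ex n : exists N, multicolor_arrows 3 n N.
Proof.
(* Induction on the number of available colours: a vertex [x] sees more than [g] others in one
   colour [i]. Either an edge of colour [i] among them closes a triangle, or [i] is no longer
   available there. *)
have bound k : exists g, forall N (c : {set 'I_N} -> 'I_n) (A : {set 'I_N})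
    (K : {set 'I_n}), #|K| <= k -> g < #|A| ->
    {in A &, forall x y, x != y -> c [set x; y] \in K} ->
  exists i x y z, [/\ [&& x != y, x != z & y != z],
    c [set x; y] = i, c [set x; z] = i & c [set y; z] = i].
  elim: k => [|k [g IH]].
    exists 1 => N c A K; rewrite leqn0 => /eqP/cards0_eq-> /card_gt1P.
    by case=> x [y [xA yA xy]] /(_ x y xA yA xy); rewrite inE.
  exists (k.+1 * g).+1 => N c A K Kk ltA cA.
  have /card_gt0P[x xA] : 0 < #|A| by apply: leq_ltn_trans ltA.
  have [||i iK ltB] := @pigeonhole _ _ (fun y => c [set x; y]) (A :\ x) K g.
  - by move=> y /setD1P[yx yA]; apply: cA; rewrite // eq_sym.
  - move: ltA; rewrite (cardsD1 x A) xA add1n ltnS; apply: leq_ltn_trans.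
    by rewrite leq_mul2r Kk orbT.
  set B := [set y in A :\ x | _] in ltB.
  have inB y : y \in B -> [/\ y != x, y \in A & c [set x; y] = i].
    by rewrite !inE => /andP[/andP[yx yA] /eqP].
  have [/exists_inP[y yB /exists_inP[z zB /andP[yz /eqP cyz]]]|noi] :=
    boolP [exists y in B, exists z in B, (y != z) && (c [set y; z] == i)].
    have [yx _ cxy] := inB y yB; have [zx _ cxz] := inB z zB.
    by exists i, x, y, z; split; rewrite // yz !(eq_sym x) yx zx.
  apply: (IH N c B (K :\ i)) => //.
    by move: Kk; rewrite (cardsD1 i K) iK.
  move=> y z yB zB yz; have [_ yA _] := inB y yB; have [_ zA _] := inB z zB.
  rewrite in_setD1 cA // andbT; apply: contra noi => cyz.
  by apply/exists_inP; exists y => //; apply/exists_inP; exists z; rewrite ?yz.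
have [g gP] := bound n; exists g.+1 => c.
have [||x y _ _ _|i [x [y [z [/and3P[xy xz yz] cxy cxz cyz]]]]] :=
  gP _ c [set: 'I_g.+1] [set: 'I_n].
- by rewrite cardsT card_ord.
- by rewrite cardsT card_ord.
- by rewrite inE.
exists i, [set x; y; z]; split.
  by rewrite setUC cardsU1 cards2 xy !inE negb_or ![z == _]eq_sym xz yz.
move=> e e_xyz /eqP/cards2P[u [v [uv eE]]]; move: e_xyz uv.
rewrite {e}eE subUset !sub1set !inE -!orbA => /andP[].
by move=> /or3P[] /eqP-> /or3P[] /eqP->; rewrite ?eqxx // setUC.
Qed.

(** * The lower bound *)

(** Without a monochromatic triangle [hi] drops strictly from jump to jump. Starting below n, it is
    0 at the last of the n jumps, leaving no value for [lo] there. *)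
Lemma jump_descent n k (J : {set 'I_k}) (chi : nat -> nat -> nat) :
    #|J| = n ->
    {in J &, forall v w : 'I_k, (w : nat) <> v.+1} ->
    (forall a b, chi a b < n) ->
    {in J, forall v : 'I_k, 0 < v /\ v.+1 < k} ->
    (forall v, v + 2 < k -> chi v.+1 v.+2 <= chi v v.+1) ->
    {in J, forall v : 'I_k,
      (1 < v -> chi v.-1 v.+1 <= chi (v - 2) v.-1) /\
      (v + 2 < k -> chi v.+1 v.+2 <= chi v.-1 v.+1)} ->
    {in J &, forall u w : 'I_k, (w : nat) = u.+2 ->
      chi u.+1 u.+3 <= chi u.-1 u.+1} ->
  exists2 v : 'I_k, v \in J &
    chi v.-1 v = chi v v.+1 /\ chi v v.+1 = chi v.-1 v.+1.
Proof.
move=> Jn sep chi_n inner path jump twin; apply: NNPP => noMono.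
pose hi v := maxn (chi v.-1 v) (chi v.-1 v.+1).
pose lo v := minn (chi v v.+1) (chi v.-1 v.+1).
(* If [hi v <= lo v], the path inequality at [v.-1] makes all three colours equal. *)
have lo_hi v : v \in J -> lo v < hi v.
  move=> vJ; have [v0 vk] := inner v vJ; rewrite ltnNge; apply/negP => hi_lo.
  have le := path v.-1; apply: noMono; exists v => //.
  have v2 : v.-1 + 2 < k by lia.
  have := le v2; rewrite prednK //; move: hi_lo; rewrite /hi /lo; lia.
have path_le : forall a b, a <= b -> b.+1 < k -> chi b b.+1 <= chi a a.+1.
  move=> a; elim=> [|b IH]; first by rewrite leqn0 => /eqP->.
  rewrite leq_eqVlt => /predU1P[->|ab bk] //.
  by apply: leq_trans (path b _) (IH _ _); lia.
have hi_le_lo v w : v \in J -> w \in J -> v < w -> hi w <= lo v.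
  move=> vJ wJ vw; have sepvw := sep v w vJ wJ.
  have [v0 vk] := inner v vJ; have [w0 wk] := inner w wJ.
  have [_ jv] := jump v vJ; have [jw _] := jump w wJ.
  (* Jumps at distance two need the [twin] inequality. Farther apart, the colours of the path edges
     from [v.+1] to [w.-1] lie between [lo v] and [hi w]. *)
  have [wE|w_ne] := eqVneq (w : nat) v.+2.
    have := twin v w vJ wJ wE; have := path v.
    move: jv jw; rewrite /hi /lo wE /= subn2 /=; lia.
  have [p1 p2] : v.+1 <= w - 2 /\ (w - 2).+1 = w.-1 by lia.
  have := path_le _ _ p1; have := path_le (w - 2) w.-1; have := path v.
  move: jv jw; rewrite /hi /lo p2 prednK //; lia.
pose s := enum J.
have sz : size s = n by rewrite -cardE.
have n0 : 0 < n by exact: leq_ltn_trans (chi_n 0 0).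
have [v0 _] : exists v, v \in J by apply/card_gt0P; rewrite Jn.
have sJ t : t < n -> nth v0 s t \in J by move=> tn; rewrite -mem_enum mem_nth ?sz.
have hi_t t : t < n -> hi (nth v0 s t) + t < n.
  elim: t => [|t IH] tn; first by rewrite addn0 /hi gtn_max !chi_n.
  have t_n := ltnW tn; have := IH t_n; have := lo_hi _ (sJ t t_n).
  suff /(hi_le_lo _ _ (sJ t t_n) (sJ _ tn)) : nth v0 s t < nth v0 s t.+1 by lia.
  have := sorted_ltn_nth ltn_trans 0 (sorted_enum_ord J).
  move=> /(_ t t.+1); rewrite !inE size_map sz !(nth_map v0) ?sz //; exact.
have nP : n.-1 < n by rewrite prednK.
by have := hi_t _ nP; have := lo_hi _ (sJ _ nP); lia.
Qed.

Lemma multicolor_arrows_lower m R :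
    ordered_arrows (monotone_path m.+3) (monotone_path_with_jumps m.+1) R ->
  multicolor_arrows 3 m.+1 R.
Proof.
move=> arr c.
pose col (e : {set 'I_R}) :=
  if enum e is [:: a; b; d] then
    if c [set a; b] < c [set b; d] then Red else Blue
  else Blue.
have colE (a b d : 'I_R) : a < b -> b < d ->
    col [set a; b; d] = if c [set a; b] < c [set b; d] then Red else Blue.
  by move=> ab bd; rewrite /col enum_three.
case: (arr col) => [[f [f_lt fP]]|[H [pathH [J [Jn jumpJ]]] [f [f_lt fP]]]].
  pose x i : 'I_R := f (inord i).
  pose chi i : nat := c [set x i; x i.+1].
  have x_lt i j : i < j -> j < m.+3 -> x i < x j.
    by move=> ij jm; apply: f_lt; rewrite !inordK // (ltn_trans ij).
  (* Colours increase strictly along the red path, so edge m + 1 would have a colour outside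
     ['I_m.+1]. *)
  have chi_i i : i < m.+2 -> i <= chi i.
    elim: i => // i IH im; apply: leq_ltn_trans (IH (ltnW im)) _.
    have i1 : i.+1 < m.+3 by exact: ltnW.
    have i2 : i.+2 < m.+3 := im.
    have i0 : i < m.+3 by exact: ltnW.
    have : triple m.+3 i i.+1 i.+2 \in path_edges m.+3.
      by rewrite inE; apply/existsP; exists (Ordinal i0); rewrite eqxx andbT.
    move/fP; rewrite (triple_ord (Ordinal i0) (Ordinal i1) (Ordinal i2)).
    have ordE t (tm : t < m.+3) : Ordinal tm = inord t.
      by apply: val_inj; rewrite /= inordK.
    rewrite !ordE imset_three colE ?x_lt // -/(x i).
    by case: ifP.
  by have := chi_i m.+1 (ltnSn _); rewrite leqNgt ltn_ord.
have [sep inner jump twin] := jumpJ.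
have [v0 v0J] : exists v, v \in J by apply/card_gt0P; rewrite Jn.
(* Positions outside [H] default to the jump [v0], which exists because n is positive. *)
pose x i : 'I_R := f (insubd v0 i).
have xE (v : 'I_(nvert H)) : x v = f v by rewrite /x valKd.
have x_lt i j : i < j -> j < nvert H -> x i < x j.
  by move=> ij jk; apply: f_lt; rewrite !val_insubd jk (ltn_trans ij jk).
pose chi a b : nat := c [set x a; x b].
have edge a b d : a < b -> b < d -> d < nvert H -> has_edge H a b d ->
    chi b d <= chi a b.
  move=> ab bd dk; have bk := ltn_trans bd dk; have ak := ltn_trans ab bk.
  rewrite /has_edge (triple_ord (Ordinal ak) (Ordinal bk) (Ordinal dk)).
  move/fP; rewrite imset_three -!xE /= colE ?x_lt //.
  by case: ifP => // /negbT; rewrite -leqNgt.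
have [| | | | | |v vJ [eq1 eq2]] := @jump_descent m.+1 _ J chi Jn.
- by move=> v w vJ wJ; apply: sep.
- by move=> a b; apply: ltn_ord.
- exact: inner.
- move=> v vk; have := pathH v vk; rewrite addn1 addn2; apply: edge; lia.
- move=> v vJ; have [v0' vk] := inner v vJ; have [jl jr] := jump v vJ.
  rewrite -subn1; split=> v_in.
    by have := jl v_in; rewrite addn1; apply: edge; lia.
  by have := jr v_in; rewrite addn1 addn2; apply: edge; lia.
- move=> u w uJ wJ wE; have [u0 uk] := inner u uJ; have [_ wk] := inner w wJ.
  have := twin u (Ordinal uk) w erefl wE uJ wJ.
  rewrite /= addn2 subSS subn1; apply: edge; lia.
have [v_gt0 vk] := inner v vJ.
have pv : v.-1 < v by lia.
have l1 := x_lt _ _ pv (ltn_ord v).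
have l2 := x_lt _ _ (ltnSn v) vk.
exists (c [set x v; x v.+1]), [set x v.-1; x v; x v.+1]; split.
  by rewrite cardE enum_three.
move=> e e_x /eqP/cards2P[a [b [ab eE]]]; move: e_x ab.
have c1 : c [set x v.-1; x v] = c [set x v; x v.+1] by apply: val_inj.
have c2 : c [set x v.-1; x v.+1] = c [set x v; x v.+1] by apply: val_inj.
rewrite {e}eE subUset !sub1set !inE -!orbA => /andP[].
by move=> /or3P[] /eqP-> /or3P[] /eqP->; rewrite ?eqxx // setUC.
Qed.

Theorem theorem1 (n : nat) (hn : 0 < n) :
  exists r R : nat,
    [/\ is_multicolor_ramsey 3 n r,
        is_ordered_ramsey (monotone_path n.+2) (monotone_path_with_jumps n) R
      & r <= R <= 4 ^ n * r].
Proof.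
case: n hn => // m _.
have [N /ex_is_least[r _ r_least]] := multicolor_arrows_ex m.+1.
have [R R_le R_least] := ex_is_least (ordered_arrows_upper r_least.1).
exists r, R; split=> //; rewrite R_le andbT.
by apply: r_least.2; apply: multicolor_arrows_lower R_least.1.
Qed.
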